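(* Let $s>0$. Let $\rho\in L^1(\mathbb{R}^n)$ satisfy $\int_{\mathbb{R}^n}\rho=1$ and $\rho\ge0$. If $\rho$ characterizes all the spaces $B^s_{p,q}$ (in the sense defined in the context), that is, if for every $1\le p\le\infty$ and every $1\le q<\infty$ $$\|f\|_{B^{s}_{p,q}}^q\sim \|f\|_{L^p}^q+\int_0^1\frac 1{\varepsilon^{sq+1}}\|f-f\ast\rho_\varepsilon\|_{L^p}^q\, d\varepsilon ,$$ then $\rho$ necessarily satisfies the moment condition $$\int_{\mathbb{R}^n}|y|^s|\rho(y)|\,dy<\infty.$$
   Context: For a function $g$ on $\mathbb{R}^n$ and $\varepsilon>0$, $g_\varepsilon(x)=\varepsilon^{-n}g(x/\varepsilon)$. Besov norm. Fix Schwartz functions $\zeta,\varphi\in\mathcal{S}(\mathbb{R}^n)$ with $\operatorname{supp}\widehat\zeta\subset B(0,2)$, $\widehat\zeta\equiv1$ in a neighborhood of $\overline{B}(0,1)$, and $\varphi:=\zeta_{1/2}-\zeta$, so that $\widehat\varphi=\widehat\zeta(\cdot/2)-\widehat\zeta$ and $\operatorname{supp}\widehat\varphi\subset B(0,4)\setminus\overline{B}(0,1)$. The (inhomogeneous) Littlewood-Paley decomposition of a temperate distribution $f$ is $f=\sum_{j\ge0}f_j$ with $f_0=f\ast\zeta$ and $f_j=f\ast\varphi_{2^{1-j}}$ for $j\ge1$. For $f\in L^p$ and $1\le q<\infty$, set $|f|_{B^s_{p,q}}^q=\sum_{j\ge0}2^{sjq}\|f_j\|_{L^p}^q$ and $\|f\|_{B^s_{p,q}}^q=\|f\|_{L^p}^q+|f|_{B^s_{p,q}}^q$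 (possibly $+\infty$). Characterization property. For $\rho\in L^1(\mathbb{R}^n)$ with $\int\rho=1$ and $s>0$, we say that $\rho$ characterizes all the spaces $B^s_{p,q}$ if for every $1\le p\le\infty$ and every $1\le q<\infty$, $$\|f\|_{B^{s}_{p,q}}^q\sim \|f\|_{L^p}^q+\int_0^1\frac 1{\varepsilon^{sq+1}}\|f-f\ast\rho_\varepsilon\|_{L^p}^q\, d\varepsilon,$$ i.e. there is a constant $C\in[1,\infty)$ (which may depend on $\rho,s,p,q,n$ but not on $f$) such that for every $f\in L^p(\mathbb{R}^n)$ each side, as an element of $[0,\infty]$, is at most $C$ times the other. *)

(* Defs.v *)
From HB Require Import structures.
From mathcomp Require Import all_boot all_order all_algebra.
From mathcomp Require Import complex.
From mathcomp Require Import all_classical all_reals all_analysis.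

Set Implicit Arguments.
Unset Strict Implicit.
Unset Printing Implicit Defensive.

Import Order.TTheory GRing.Theory Num.Theory.
Import numFieldNormedType.Exports.

Local Open Scope classical_set_scope.
Local Open Scope ring_scope.

(* The product sigma-algebra on row vectors, following the library's
   sigma-algebra on n.-tuple T; row vectors are used instead of tuples because
   they carry the normed-space structure needed for derivatives. *)
Definition measure_rV_display : measure_display -> measure_display.
Proof. exact. Qed.

Section measurable_rV.
Context {d} {T : measurableType d}.
Variable n : nat.

Let coors : 'I_n -> 'rV[T]_n -> T := fun i x => x ord0 i.

Let rV_set0 : g_sigma_preimage coors set0.
Proof. exact: sigma_algebra0. Qed.

Let rV_setC A : g_sigma_preimage coors A -> g_sigma_preimage coors (~` A).
Proof. exact: sigma_algebraC. Qed.

Let rV_bigcup (F : _^nat) : (forall i, g_sigma_preimage coors (F i)) ->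
  g_sigma_preimage coors (\bigcup_i (F i)).
Proof. exact: sigma_algebra_bigcup. Qed.

HB.instance Definition _ := @isMeasurable.Build (measure_rV_display d)
  ('rV[T]_n) (g_sigma_preimage coors) rV_set0 rV_setC rV_bigcup.

End measurable_rV.

Section measurable_rV_lemmas.
Context d1 d2 (T1 : measurableType d1) (T2 : measurableType d2).

Lemma measurable_coord n (i : 'I_n) :
  measurable_fun [set: 'rV[T2]_n] (fun x : 'rV[T2]_n => x ord0 i).
Proof.
move=> _ Y mY; rewrite setTI; apply: sub_sigma_algebra => /=.
rewrite -bigcup_seq/=; exists i => /=; first by rewrite mem_index_enum.
by exists Y => //; rewrite setTI.
Qed.

Lemma measurable_fun_rVP n (f : T1 -> 'rV[T2]_n) :
  measurable_fun [set: T1] f <->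
  forall i, measurable_fun [set: T1] (fun x => f x ord0 i).
Proof.
split=> [mf i|mf].
  exact: (measurableT_comp (measurable_coord i) mf).
pose G := \big[setU/set0]_(i < n)
  preimage_set_system setT (fun x : 'rV[T2]_n => x ord0 i) measurable.
have mG : measurable = <<s G >> by [].
apply: (measurability _ mG) => _ [B GB <-].
move: GB; rewrite /G -bigcup_seq => -[i _ [C mC <-]].
rewrite !setTI; have := mf i measurableT _ mC.
by rewrite setTI.
Qed.

End measurable_rV_lemmas.

Definition cons_rV (T : Type) n (p : T * 'rV[T]_n) : 'rV[T]_n.+1 :=
  \row_i (if unlift ord0 i is Some j then p.2 ord0 j else p.1).

Definition uncons_rV (T : Type) n (x : 'rV[T]_n.+1) : T * 'rV[T]_n :=
  (x ord0 ord0, \row_j x ord0 (lift ord0 j)).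

Lemma cons_rVK (T : Type) n : cancel (@cons_rV T n) (@uncons_rV T n).
Proof.
case=> a v; rewrite /uncons_rV /cons_rV; congr pair.
  by rewrite mxE unlift_none.
by apply/rowP => j; rewrite !mxE liftK.
Qed.

Lemma uncons_rVK (T : Type) n : cancel (@uncons_rV T n) (@cons_rV T n).
Proof.
move=> x; apply/rowP => i; rewrite mxE.
by case: unliftP => [j|] -> //=; rewrite mxE.
Qed.

Lemma measurable_cons_rV d (T : measurableType d) n :
  measurable_fun [set: T * 'rV[T]_n] (@cons_rV T n).
Proof.
apply/measurable_fun_rVP => i; case: (unliftP ord0 i) => [j|] ->.
- rewrite (_ : (fun _ => _) = (fun v : 'rV[T]_n => v ord0 j) \o snd).
    exact: (measurableT_comp (measurable_coord j) measurable_snd).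
  by apply/funext => p /=; rewrite mxE liftK.
- rewrite (_ : (fun _ => _) = fst); first exact: measurable_fst.
  by apply/funext => p /=; rewrite mxE unlift_none.
Qed.

Lemma measurable_uncons_rV d (T : measurableType d) n :
  measurable_fun [set: 'rV[T]_n.+1] (@uncons_rV T n).
Proof.
apply/measurable_fun_pairP; split; first exact: measurable_coord.
apply/measurable_fun_rVP => i.
rewrite (_ : (fun _ => _) = fun x : 'rV[T]_n.+1 => x ord0 (lift ord0 i)).
  exact: measurable_coord.
by apply/funext => x /=; rewrite mxE.
Qed.

Section lebesgue_rV.
Context {R : realType}.

Section step.
Variables (n : nat) (m : {sigma_finite_measure set 'rV[R]_n -> \bar R}).

Definition lebesgue_rV_step : set 'rV[R]_n.+1 -> \bar R :=
  pushforward (@lebesgue_measure R \x m)%E (@cons_rV R n).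

Let step0 : lebesgue_rV_step set0 = 0%E.
Proof. by rewrite /lebesgue_rV_step /pushforward preimage_set0 measure0. Qed.

Let step_ge0 A : (0 <= lebesgue_rV_step A)%E.
Proof. by rewrite /lebesgue_rV_step /pushforward. Qed.

Let step_sigma_additive : semi_sigma_additive lebesgue_rV_step.
Proof.
move=> F mF tF mUF; rewrite /lebesgue_rV_step /pushforward preimage_bigcup.
apply: measure_semi_sigma_additive.
- by move=> k; rewrite -[X in measurable X]setTI; apply: (@measurable_cons_rV _ R n) => //.
- apply/trivIsetP => /= i j _ _ ij; rewrite -preimage_setI.
  by move/trivIsetP : tF => /(_ _ _ _ _ ij) ->//; rewrite preimage_set0.
- rewrite -preimage_bigcup -[X in measurable X]setTI.
  exact: (@measurable_cons_rV _ R n).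
Qed.

HB.instance Definition _ := isMeasure.Build _ _ _ lebesgue_rV_step
  step0 step_ge0 step_sigma_additive.

Let step_sigma_finite : sigma_finite setT lebesgue_rV_step.
Proof.
have /sigma_finiteP[F [TF ndF Foo]] := sigma_finiteT (@lebesgue_measure R).
have /sigma_finiteP[G [TG ndG Goo]] := sigma_finiteT m.
exists (fun k => @uncons_rV R n @^-1` (F k `*` G k)).
  rewrite -preimage_bigcup (_ : \bigcup_k _ = setT) ?preimage_setT//.
  rewrite -setXTT TF TG predeqE => -[x y]; split.
    by move=> [k _ []/= ? ?]; split; exists k.
  move=> [/= [k _ Fkx] [l _ Gly]]; exists (maxn k l) => //; split.
  - by move: x Fkx; exact/subsetPset/ndF/leq_maxl.
  - by move: y Gly; exact/subsetPset/ndG/leq_maxr.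
move=> k; have [mF Fk] := Foo k; have [mG Gk] := Goo k.
have mFG : measurable (F k `*` G k) by exact: measurableX.
split.
  by rewrite -[X in measurable X]setTI; apply: (@measurable_uncons_rV _ R n).
rewrite /lebesgue_rV_step /pushforward -comp_preimage.
rewrite (_ : _ \o _ = id) ?preimage_id.
  by rewrite product_measure1E// lte_mul_pinfty// ge0_fin_numE.
by apply/funext => p; rewrite /= cons_rVK.
Qed.

HB.instance Definition _ := Measure_isSigmaFinite.Build _ _ _ lebesgue_rV_step
  step_sigma_finite.

End step.

(* n-dimensional Lebesgue measure, as an iterated product through the bijection
   cons_rV between R * R^k and R^(k+1). *)
Fixpoint lebesgue_rV (n : nat) :
    {sigma_finite_measure set 'rV[R]_n -> \bar R} :=
  if n is k.+1 then lebesgue_rV_step (lebesgue_rV k) else \d_(0 : 'rV[R]_0).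

End lebesgue_rV.

Section complex_functions.
Context {R : realType} {n : nat}.
Local Notation mu := (lebesgue_rV n : {measure set 'rV[R]_n -> \bar R}).
Implicit Types (f g : 'rV[R]_n -> R[i]) (x y xi : 'rV[R]_n) (p : \bar R).

Definition dotp x y : R := \sum_(i < n) x ord0 i * y ord0 i.

(* The norm `|x| of the library on 'rV[R]_n is the sup norm. *)
Definition enorm x : R := Num.sqrt (dotp x x).

Definition cmeasurable f : Prop :=
  measurable_fun [set: 'rV[R]_n] (fun x => complex.Re (f x)) /\
  measurable_fun [set: 'rV[R]_n] (fun x => complex.Im (f x)).

(* Componentwise; each component is 0 by convention where it is not integrable. *)
Definition cintegral f : R[i] :=
  Complex (\int[mu]_x complex.Re (f x)) (\int[mu]_x complex.Im (f x)).

Definition cLnorm p f : \bar R :=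
  Lnorm mu p (fun x => (Normc.normc (f x))%:E).

Definition in_Lp p f : Prop := cmeasurable f /\ (cLnorm p f < +oo)%E.

Definition convolution f g : 'rV[R]_n -> R[i] :=
  fun x => cintegral (fun y => f (x - y) * g y).

Definition dilation (eps : R) g : 'rV[R]_n -> R[i] :=
  fun x => (eps ^- n)%:C%C * g (eps^-1 *: x).

(* Normalised with the kernel e^(-i <x, xi>). *)
Definition fourier f : 'rV[R]_n -> R[i] :=
  fun xi => cintegral
    (fun x => f x * Complex (cos (dotp x xi)) (- sin (dotp x xi))).

(* [partials [:: i1; ...; ik] u] is d_i1 ... d_ik u: lists of directions stand
   for multi-indices. *)
Fixpoint partials (l : seq 'I_n) (u : 'rV[R]_n -> R) : 'rV[R]_n -> R :=
  if l is i :: l' then fun x => 'D_(delta_mx ord0 i) (partials l' u) x else u.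

(* Differentiability of every iterated partial derivative amounts to C^oo. *)
Definition real_schwartz (u : 'rV[R]_n -> R) : Prop :=
  (forall l x, differentiable (partials l u) x) /\
  (forall l (N : nat), exists M : R, forall x,
      enorm x ^+ N * `|partials l u x| <= M).

Definition schwartz f : Prop :=
  real_schwartz (fun x => complex.Re (f x)) /\
  real_schwartz (fun x => complex.Im (f x)).

Definition littlewood_paley_cutoff (zeta : 'rV[R]_n -> R[i]) : Prop :=
  [/\ schwartz zeta,
      closure [set xi | fourier zeta xi != 0] `<=` [set xi | enorm xi < 2] &
      exists U : set 'rV[R]_n,
        [/\ open U, [set xi | enorm xi <= 1] `<=` U &
            forall xi, U xi -> fourier zeta xi = 1]].

Definition lp_phi (zeta : 'rV[R]_n -> R[i]) : 'rV[R]_n -> R[i] :=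
  fun x => dilation 2^-1 zeta x - zeta x.

Definition lp_block (zeta : 'rV[R]_n -> R[i]) f (j : nat) : 'rV[R]_n -> R[i] :=
  if j == 0%N then convolution f zeta
  else convolution f (dilation (2 `^ (1 - j%:R)) (lp_phi zeta)).

(* The quantities below are q-th powers of (semi)norms, valued in [0, +oo]. *)
Definition besov_seminorm_pow zeta (s : R) p (q : R) f : \bar R :=
  (\sum_(0 <= j <oo)
     (2 `^ (s * j%:R * q))%:E * cLnorm p (lp_block zeta f j) `^ q)%E.

Definition besov_norm_pow zeta (s : R) p (q : R) f : \bar R :=
  (cLnorm p f `^ q + besov_seminorm_pow zeta s p q f)%E.

Definition approximation_pow (rho : 'rV[R]_n -> R[i]) (s : R) p (q : R) f
    : \bar R :=
  (cLnorm p f `^ q +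
   \int[@lebesgue_measure R]_(eps in `]0%R, 1%R[)
     ((eps `^ (s * q + 1))^-1%:E *
      cLnorm p (fun x => f x - convolution f (dilation eps rho) x)%R `^ q))%E.

Definition characterizes_besov zeta (rho : 'rV[R]_n -> R[i]) (s : R) : Prop :=
  forall p (q : R), (1 <= p)%E -> 1 <= q ->
    exists C : R, 1 <= C /\
      forall f, in_Lp p f ->
        (besov_norm_pow zeta s p q f <= C%:E * approximation_pow rho s p q f)%E
        /\
        (approximation_pow rho s p q f <= C%:E * besov_norm_pow zeta s p q f)%E.

End complex_functions.

(* Main.v *)
(* Test the characterization with p = +oo, q = 1 on the plane waves
   f(x) = exp(i x_k).  Convolving f with g multiplies it by the Fourier
   transform of g at e_k, so every Littlewood-Paley block of index j >= 1
   vanishes (the transform of zeta is 1 on the closed unit ball) and the Besov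
   norm of f is finite.  On the other side, since rho >= 0 has integral 1,
   |f - f * rho_eps| is constant and at least
   \int rho(y) (1 - cos (eps y_k)) dy.  By Tonelli the approximation integral
   dominates \int rho(y) \int_0^1 eps^(-s-1) (1 - cos (eps y_k)) deps dy, and
   for |t| >= 1 the values eps in ]1/(2|t|), 1/|t|[ alone contribute a multiple
   of |t|^s to \int_0^1 eps^(-s-1) (1 - cos (eps t)) deps.  Hence every |y_k|^s
   has finite integral against rho. *)
Require Import Defs.
From HB Require Import structures.
From mathcomp Require Import all_boot all_order all_algebra.
From mathcomp Require Import complex.
From mathcomp Require Import all_classical all_reals all_analysis.
From mathcomp Require Import measurable_realfun ess_sup_inf ring lra.

Set Implicit Arguments.
Unset Strict Implicit.
Unset Printing Implicit Defensive.

Import Order.TTheory GRing.Theory Num.Theory.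
Import numFieldNormedType.Exports.

Local Open Scope classical_set_scope.
Local Open Scope ring_scope.

(** * Iterated integration, scaling and measurability on row vectors *)

Section lebesgue_rV_theory.
Context {R : realType}.

(** By construction [lebesgue_rV n.+1] is the image of a product measure under [cons_rV], so a
    change of variables followed by Tonelli peels off the first coordinate. This drives the
    inductions on the dimension below. *)
Lemma integral_rVS n (F : 'rV[R]_n.+1 -> \bar R) :
  measurable_fun [set: 'rV[R]_n.+1] F -> (forall x, 0 <= F x)%E ->
  (\int[lebesgue_rV n.+1]_x F x =
   \int[@lebesgue_measure R]_a \int[lebesgue_rV n]_v F (cons_rV (a, v)))%E.
Proof.
move=> mF F0.
have mcons : measurable_fun [set: measurableTypeR R * 'rV[R]_n]
    (@cons_rV R n : measurableTypeR R * 'rV[R]_n -> 'rV[R]_n.+1).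
  exact: (@measurable_cons_rV _ R n).
have <- : (\int[(@lebesgue_measure R \x lebesgue_rV n)%E]_z
      (F \o @cons_rV R n) z =
    \int[lebesgue_rV n.+1]_x F x)%E.
  transitivity (\int[(@lebesgue_measure R \x lebesgue_rV n)%E]_(x in
      (@cons_rV R n) @^-1` setT) (F \o @cons_rV R n) x)%E.
    by rewrite preimage_setT.
  rewrite -(ge0_integral_pushforward mcons _ measurableT mF (fun x _ => F0 x)).
  by apply: eq_measure_integral.
apply: (fubini_tonelli1 (m1 := @lebesgue_measure R) (m2 := lebesgue_rV n)
  (F \o @cons_rV R n)) => [|x]; last exact: F0.
exact: measurableT_comp.
Qed.

(** Uniqueness of Lebesgue measure: [eps] times the image of Lebesgue measure under multiplication
    by [eps] gives every interval []a, b]] its length. *)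
Lemma ge0_integral_scale1 (eps : R) (F : R -> \bar R) : 0 < eps ->
  measurable_fun [set: measurableTypeR R] F -> (forall x, 0 <= F x)%E ->
  (\int[@lebesgue_measure R]_x F (eps * x)%R =
   eps^-1%:E * \int[@lebesgue_measure R]_x F x)%E.
Proof.
move=> eps0 mF F0.
have mM : measurable_fun [set: measurableTypeR R]
    ( *%R eps : measurableTypeR R -> measurableTypeR R).
  exact: mulrl_measurable.
have e0 : 0 <= eps by exact: ltW.
have e0' : 0 <= eps^-1 by rewrite invr_ge0.
have := ge0_integral_pushforward mM (@lebesgue_measure R) measurableT mF
  (fun x _ => F0 x).
rewrite preimage_setT => <-.
rewrite -(ge0_integral_mscale (@lebesgue_measure R) measurableT (NngNum e0')
  mF)//.
apply: eq_measure_integral => A mA _.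
pose P : {measure set (measurableTypeR R) -> \bar R} :=
  measure_function_pushforward__canonical__measure_function_Measure
    (@lebesgue_measure R) mM.
have H : lebesgue_measure A = mscale (NngNum e0) P A.
  apply: (@lebesgue_measure_unique _ (mscale (NngNum e0) P)) =>
    // _ [[a b]] _ <-.
  transitivity (eps%:E * lebesgue_measure ( *%R eps @^-1` `]a, b]%classic))%E;
    last by [].
  rewrite (_ : _ @^-1` _ = `](eps^-1 * a), (eps^-1 * b)]%classic); last first.
    apply/seteqP; split => x /=; rewrite !in_itv/= ![eps^-1 * _]mulrC
      ltr_pdivrMr// ler_pdivlMr// mulrC//.
  rewrite !lebesgue_measure_itv/= !lte_fin ltr_pM2l ?invr_gt0//.
  case: ifPn => ab; last by rewrite mule0.
  by rewrite -!EFinB -EFinM -mulrBr mulrA divff ?gt_eqF// mul1r.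
transitivity (eps^-1%:E * lebesgue_measure A)%E; last by [].
have {}H : lebesgue_measure A = (eps%:E * P A)%E := H.
by rewrite H muleA -EFinM mulVf ?gt_eqF// mul1e.
Qed.

(** Induction on the dimension: the inner k coordinates contribute [eps ^- k] and the first
    coordinate one more [eps^-1]. *)
Lemma ge0_integral_scale n (eps : R) (F : 'rV[R]_n -> \bar R) : 0 < eps ->
  measurable_fun [set: 'rV[R]_n] F -> (forall x, 0 <= F x)%E ->
  (\int[lebesgue_rV n]_x F (eps *: x)%R =
   (eps ^- n)%:E * \int[lebesgue_rV n]_x F x)%E.
Proof.
move=> eps0.
have mZ m : measurable_fun [set: 'rV[R]_m] ( *:%R eps : 'rV[R]_m -> 'rV[R]_m).
  apply/measurable_fun_rVP => i.
  under eq_fun do rewrite mxE.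
  by apply: measurable_funM => //; exact: measurable_coord.
elim: n F => [|k IH] F mF F0.
  (* In dimension 0 the measure is the Dirac mass at the only vector, so both sides equal [F 0]. *)
  rewrite /= !integral_dirac//; last exact: (measurableT_comp mF (mZ _)).
  by rewrite scaler0 expr0 invr1 !mul1e.
have mFe : measurable_fun [set: 'rV[R]_k.+1] (fun x => F (eps *: x)).
  exact: (measurableT_comp mF (mZ _)).
rewrite (integral_rVS mF)// (integral_rVS mFe)//.
have mc : measurable_fun setT (F \o @cons_rV R k).
  by apply: measurableT_comp => //; exact: measurable_cons_rV.
have mG := measurable_fun_fubini_tonelli_F (m2 := lebesgue_rV k) 
  (F \o @cons_rV R k) mc (fun x => F0 _).
have G0 a : (0 <= \int[lebesgue_rV k]_v F (cons_rV (a, v)))%E.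
  exact: integral_ge0.
transitivity (\int[@lebesgue_measure R]_a ((eps ^- k)%:E *
    \int[lebesgue_rV k]_v F (cons_rV (eps * a, v))%R))%E.
  apply: eq_integral => a _.
  rewrite -(IH (fun v => F (cons_rV (eps * a, v))))//.
    apply: eq_integral => v _; congr F; apply/rowP => i.
    by rewrite !mxE; case: unlift => //= j; rewrite mxE.
  exact: (measurableT_comp mc (pair1_measurable (eps * a))).

rewrite ge0_integralZl//; last 2 first.
- apply: (measurableT_comp mG).
  exact: mulrl_measurable.
- by rewrite lee_fin invr_ge0 exprn_ge0// ltW.
rewrite (@ge0_integral_scale1 _
  (fun a => \int[lebesgue_rV k]_v F (cons_rV (a, v))))%E//.
by rewrite muleA -EFinM -invfM -exprSr.
Qed.

Lemma continuous_measurable_rV n (f : 'rV[R]_n -> R) :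
  continuous f -> measurable_fun [set: 'rV[R]_n] f.
Proof.
move=> cf.
(* f is the pointwise limit of f composed with rounding to Z^n / (k + 1). *)
pose idx k (x : 'rV[R]_n) : 'rV[int]_n := \row_i Num.floor (k.+1%:R * x ord0 i).
pose rd k (m : 'rV[int]_n) : 'rV[R]_n := \row_i ((m ord0 i)%:~R / k.+1%:R).
have mi k m : measurable [set x : 'rV[R]_n | idx k x = m].
  (* Each cell of the rounding is a finite intersection of half-open slabs, one for each
     coordinate. *)
  rewrite [X in measurable X](_ : _ =
      \bigcap_(i in setT) [set x : 'rV[R]_n |
        Num.floor (k.+1%:R * x ord0 i) = m ord0 i]).
    apply: fin_bigcap_measurable => // i _.
    pose I := `[((m ord0 i)%:~R / k.+1%:R : R),
      ((m ord0 i + 1)%:~R / k.+1%:R)[%classic.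
    have mI : measurable I by exact: measurable_itv.
    have := measurable_coord (T2 := R) i measurableT mI.
    rewrite setTI; congr measurable; apply/seteqP; split => x;
      rewrite /= /I/= in_itv/= ler_pdivrMr ?ltr0n// ltr_pdivlMr ?ltr0n// mulrC.
      by rewrite -floor_eq => /eqP.
    by rewrite -floor_eq => ->.
  apply/seteqP; split => x /=.
    by move=> <- i _; rewrite mxE.
  by move=> H; apply/rowP => i; rewrite mxE H.
apply: (@measurable_fun_cvg _ _ _ _ (fun k x => f (rd k (idx k x)))).
- move=> k _ Y mY; rewrite setTI.
  (* The rounded function is constant on cells indexed by a countable type, so every preimage is a
     countable union of cells. *)
  rewrite [X in measurable X](_ : _ =
      \bigcup_(m in [set m | Y (f (rd k m))]) [set x : 'rV[R]_n | idx k x = m]).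
    rewrite bigcup_mkcond; apply: countable_bigcupT_measurable => // m.
    by case: ifP.
  apply/seteqP; split => x /=.
    by move=> H; exists (idx k x).
  by case=> m /= Hm ->.
- move=> x _; apply: (continuous_cvg _ (cf x)).
  apply/cvg_ballP => e e0.
  near=> k.
  split=> // i j; rewrite (ord1 i) /ball/= !mxE.
  have k0 : 0 < k.+1%:R :> R by rewrite ltr0n.
  have /andP[h1 h2] := floor_itv (k.+1%:R * x ord0 j).
  (* Rounding down moves every coordinate by at most 1/(k+1). *)
  apply: (@le_lt_trans _ _ k.+1%:R^-1); last first.
    by near: k; exact: (near_infty_natSinv_lt (PosNum e0)).
  rewrite ger0_norm.
    rewrite lerBlDr -[X in X + _]mul1r -mulrDl ler_pdivlMr// mulrC addrC.
    by move: h2; rewrite intrD => /ltW.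
  by rewrite subr_ge0 ler_pdivrMr// [leRHS]mulrC.
Unshelve. all: by end_near.
Qed.

End lebesgue_rV_theory.

(** * Integrability of Schwartz functions *)

Section integrability.
Context {R : realType}.

(** The integrand is even, so the half-line value pi/2 is doubled. *)
Lemma integral_oneDsqrV :
  (\int[@lebesgue_measure R]_x ((oneDsqr x)^-1)%:E = (pi : R)%:E)%E.
Proof.
rewrite ge0_symfun_integralT.
- rewrite (_ : [set x : R | 0 <= x] = `[0, +oo[%classic); last first.
    by apply/seteqP; split => x /=; rewrite in_itv/= andbT.
  rewrite integral0y_oneDsqr -EFinM; congr EFin.
  by rewrite mulrC divfK// pnatr_eq0.
- by move=> x; rewrite invr_ge0 (le_trans ler01)// oneDsqr_ge1.
- exact: continuous_oneDsqrV.
- by move=> x /=; rewrite /oneDsqr sqrrN.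
Qed.

(* The integrable majorant, up to a constant, of Schwartz functions. *)
Definition cauchy_weight n (x : 'rV[R]_n) : R :=
  \prod_(i < n) (oneDsqr (x ord0 i))^-1.

Lemma measurable_cauchy_weight n :
  measurable_fun [set: 'rV[R]_n]
    (@cauchy_weight n).
Proof.
apply: measurable_prod => i _.
apply: (measurableT_comp (f := fun t : R => (oneDsqr t)^-1)).
  by apply: continuous_measurable_fun; exact: continuous_oneDsqrV.
exact: measurable_coord.
Qed.

Lemma cauchy_weight_ge0 n (x : 'rV[R]_n) :
  0 <= cauchy_weight x.
Proof.
by apply: prodr_ge0 => i _; rewrite invr_ge0 (le_trans ler01)// oneDsqr_ge1.
Qed.

(** The weight factors over the coordinates, and each coordinate peeled off contributes a factor
    pi. *)
Lemma integral_cauchy_weight n :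
  (\int[lebesgue_rV n]_x (cauchy_weight x)%:E
   = (pi ^+ n)%:E)%E.
Proof.
elim: n => [|n IH].
  rewrite /= integral_dirac//.
    by rewrite diracT /cauchy_weight big_ord0 mul1e.
  by apply/measurable_EFinP; exact: measurable_cauchy_weight.
rewrite (@integral_rVS _ _ (EFin \o @cauchy_weight n.+1)).
- transitivity (\int[@lebesgue_measure R]_a ((pi ^+ n)%:E * ((oneDsqr a)^-1)%:E))%E.
    apply: eq_integral => a _.
    transitivity (\int[lebesgue_rV n]_v
       (((oneDsqr a)^-1)%:E * (cauchy_weight v)%:E))%E.
      apply: eq_integral => v _; rewrite -EFinM /= /cauchy_weight big_ord_recl.
      congr (_ * _)%:E; first by rewrite mxE unlift_none.
      by apply: eq_bigr => i _; rewrite mxE liftK.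
    rewrite ge0_integralZl//.
    + by rewrite IH muleC.
    + by apply/measurable_EFinP; exact: measurable_cauchy_weight.
    + by move=> x _; rewrite lee_fin; exact: cauchy_weight_ge0.
  rewrite ge0_integralZl//.
  + by rewrite integral_oneDsqrV -EFinM -exprSr.
  + apply/measurable_EFinP.
    by apply: continuous_measurable_fun; exact: continuous_oneDsqrV.
  + by rewrite lee_fin exprn_ge0// pi_ge0.
- by apply/measurable_EFinP; exact: measurable_cauchy_weight.
- by move=> x; rewrite /= lee_fin; exact: cauchy_weight_ge0.
Qed.

Lemma sqr_coord_le_dotp n (x : 'rV[R]_n) i : x ord0 i ^+ 2 <= dotp x x.
Proof.
rewrite /dotp (bigD1 i)//= -expr2 lerDl.
by apply: sumr_ge0 => j _; rewrite -expr2 sqr_ge0.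
Qed.

Lemma dotp_ge0 n (x : 'rV[R]_n) : 0 <= dotp x x.
Proof. by apply: sumr_ge0 => j _; rewrite -expr2 sqr_ge0. Qed.

Lemma sqr_enorm n (x : 'rV[R]_n) : enorm x ^+ 2 = dotp x x.
Proof. by rewrite /enorm sqr_sqrtr// dotp_ge0. Qed.

(** Decay of orders 0 and 2n bounds |u| (1 + |x|^2)^n, and this power dominates the product of the 1
    + x_i^2, the inverse of [cauchy_weight]. *)
Lemma real_schwartz_integrable n (u : 'rV[R]_n -> R) :
  real_schwartz u -> (lebesgue_rV n).-integrable setT (EFin \o u).
Proof.
move=> [du decay].
have [M0 hM0] := decay [::] 0%N.
have [M1 hM1] := decay [::] (2 * n)%N.
have {}hM0 x : `|u x| <= M0 by have := hM0 x; rewrite expr0 mul1r.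
have {}hM1 x : dotp x x ^+ n * `|u x| <= M1.
  by have := hM1 x; rewrite exprM sqr_enorm.
have M00 : 0 <= M0 by rewrite (le_trans _ (hM0 0)).
have M10 : 0 <= M1.
  by rewrite (le_trans _ (hM1 0))// mulr_ge0// exprn_ge0// dotp_ge0.
(* With d = [dotp x x], (1 + d)^n is at most 2^n if d <= 1, where M0 serves, and at most 2^n d^n if
   d > 1, where M1 serves. *)
pose C := 2 ^+ n * (M0 + M1).
pose g (x : 'rV[R]_n) := C * cauchy_weight x.
have mu : measurable_fun [set: 'rV[R]_n] u.
  apply: continuous_measurable_rV => x.
  exact/differentiable_continuous/(du [::]).
apply: (@le_integrable _ _ _ _ _ _ _ (EFin \o g)) => //.
- exact/measurable_EFinP.
- move=> x _ /=; rewrite lee_fin [leRHS]ger0_norm; last first.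
    by rewrite mulr_ge0 ?cauchy_weight_ge0// mulr_ge0 ?exprn_ge0 ?addr_ge0.
  rewrite /g /cauchy_weight prodfV ler_pdivlMr; last first.
    by apply: prodr_gt0 => i _; rewrite (lt_le_trans ltr01)// oneDsqr_ge1.
  apply: (@le_trans _ _ (`|u x| * (1 + dotp x x) ^+ n)).
    apply: ler_wpM2l => //.
    have -> : (1 + dotp x x) ^+ n = \prod_(i < n) (1 + dotp x x).
      by rewrite prodr_const card_ord.
    apply: ler_prod => i _.
    rewrite (le_trans ler01) ?oneDsqr_ge1//= /oneDsqr lerD2l.
    exact: sqr_coord_le_dotp.
  have d0 := dotp_ge0 x.
  have [d1|d1] := leP (dotp x x) 1.
    apply: (@le_trans _ _ (M0 * 2 ^+ n)).
      apply: ler_pM => //; first by rewrite exprn_ge0// addr_ge0.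
      by apply: lerXn2r; rewrite ?nnegrE ?addr_ge0//; lra.
    by rewrite /C mulrC ler_wpM2l ?exprn_ge0// lerDl.
  apply: (@le_trans _ _ (`|u x| * (2 * dotp x x) ^+ n)).
    apply: ler_wpM2l => //.
    by apply: lerXn2r; rewrite ?nnegrE ?addr_ge0 ?mulr_ge0//; lra.
  rewrite exprMn mulrCA /C ler_wpM2l ?exprn_ge0// mulrC.
  by rewrite (le_trans (hM1 x))// lerDr.
- apply: (eq_integrable _ (fun x => C%:E * (cauchy_weight x)%:E)%E) => //.
  apply: integrableZl => //; apply/integrableP; split.
    by apply/measurable_EFinP; exact: measurable_cauchy_weight.
  under eq_integral => x _ do rewrite gee0_abs ?lee_fin ?cauchy_weight_ge0//.
  by rewrite integral_cauchy_weight ltry.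
Qed.

End integrability.

(** * Change of variables under dilation *)

Section dilation_integral.
Context {R : realType} {n : nat}.
Local Notation mu := (lebesgue_rV n : {measure set 'rV[R]_n -> \bar R}).

Lemma measurable_scale_rV (c : R) :
  measurable_fun [set: 'rV[R]_n] ( *:%R c : 'rV[R]_n -> 'rV[R]_n).
Proof.
apply/measurable_fun_rVP => i; under eq_fun do rewrite mxE.
by apply: measurable_funM => //; exact: measurable_coord.
Qed.

Lemma ge0_integral_dilation (eps : R) (F : 'rV[R]_n -> \bar R) : 0 < eps ->
  measurable_fun [set: 'rV[R]_n] F -> (forall x, 0 <= F x)%E ->
  (\int[mu]_x ((eps ^- n)%:E * F (eps^-1 *: x)%R) = \int[mu]_x F x)%E.
Proof.
move=> e0 mF F0.
rewrite ge0_integralZl//; last 2 first.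
- exact: (measurableT_comp mF (measurable_scale_rV _)).
- by rewrite lee_fin invr_ge0 exprn_ge0// ltW.
rewrite ge0_integral_scale ?invr_gt0// exprVn invrK muleA -EFinM.
by rewrite mulVf ?mul1e// expf_neq0// gt_eqF.
Qed.

(** Positive and negative parts are rescaled separately, so the two sides are already the same
    extended difference before [fine] is applied. *)
Lemma Rintegral_dilation (eps : R) (G : 'rV[R]_n -> R) : 0 < eps ->
  measurable_fun [set: 'rV[R]_n] G ->
  \int[mu]_x (eps ^- n * G (eps^-1 *: x)) = \int[mu]_x G x.
Proof.
move=> e0 mG; have k0 : 0 <= eps ^- n by rewrite invr_ge0 exprn_ge0// ltW.
have mEG : measurable_fun [set: 'rV[R]_n] (EFin \o G) by exact/measurable_EFinP.
congr fine; rewrite integralE [RHS]integralE; congr (_ - _)%E.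
  rewrite (_ : _^\+%E = fun x =>
      ((eps ^- n)%:E * (EFin \o G)^\+%E (eps^-1 *: x)%R)%E).
    by apply: ge0_integral_dilation => //; exact: measurable_funepos.
  under eq_fun do rewrite EFinM.
  rewrite (ge0_funeposM (fun x : 'rV[R]_n => (G (eps^-1 *: x))%:E) k0).
  by apply/funext => x; rewrite !funeposE.
rewrite (_ : _^\-%E = fun x =>
      ((eps ^- n)%:E * (EFin \o G)^\-%E (eps^-1 *: x)%R)%E).
  by apply: ge0_integral_dilation => //; exact: measurable_funeneg.
under eq_fun do rewrite EFinM.
rewrite (ge0_funenegM (fun x : 'rV[R]_n => (G (eps^-1 *: x))%:E) k0).
by apply/funext => x; rewrite !funenegE.
Qed.

Lemma integrable_dilation (eps : R) (G : 'rV[R]_n -> R) : 0 < eps ->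
  mu.-integrable setT (EFin \o G) ->
  mu.-integrable setT (fun x => (eps ^- n * G (eps^-1 *: x))%:E).
Proof.
move=> e0 /integrableP[mG iG].
have k0 : 0 <= eps ^- n by rewrite invr_ge0 exprn_ge0// ltW.
have mG' : measurable_fun [set: 'rV[R]_n] G by exact/measurable_EFinP.
apply/integrableP; split.
  apply/measurable_EFinP; apply: measurable_funM => //.
  exact: (measurableT_comp mG' (measurable_scale_rV _)).
rewrite (_ : integral _ _ _ = \int[mu]_x `|(EFin \o G) x|)%E//.
rewrite -(ge0_integral_dilation e0)//; last exact: measurableT_comp.
apply: eq_integral => x _; rewrite /= normrM EFinM.
by rewrite (ger0_norm k0).
Qed.

End dilation_integral.

(** * Complex integrals, Fourier transform and plane waves *)

Section complex_integral.
Context {R : realType} {n : nat}.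
Local Notation mu := (lebesgue_rV n : {measure set 'rV[R]_n -> \bar R}).
Implicit Types (f g : 'rV[R]_n -> R[i]) (x y xi : 'rV[R]_n).

Definition cintegrable f : Prop :=
  mu.-integrable setT (fun x => (complex.Re (f x))%:E) /\
  mu.-integrable setT (fun x => (complex.Im (f x))%:E).

Lemma complex_ReM (a b : R[i]) : complex.Re (a * b) =
  complex.Re a * complex.Re b - complex.Im a * complex.Im b.
Proof. by case: a b => [? ?] []. Qed.

Lemma complex_ImM (a b : R[i]) : complex.Im (a * b) =
  complex.Re a * complex.Im b + complex.Im a * complex.Re b.
Proof. by case: a b => [? ?] []. Qed.

Lemma complex_ReB (a b : R[i]) : complex.Re (a - b) = complex.Re a - complex.Re b.
Proof. by case: a b => [? ?] []. Qed.

Lemma complex_ImB (a b : R[i]) : complex.Im (a - b) = complex.Im a - complex.Im b.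
Proof. by case: a b => [? ?] []. Qed.

Lemma complex_eq (a b : R[i]) : complex.Re a = complex.Re b ->
  complex.Im a = complex.Im b -> a = b.
Proof. by case: a b => [? ?] [? ?] /= -> ->. Qed.

Lemma cintegrable_measurable f : cintegrable f -> cmeasurable f.
Proof.
by move=> [/measurable_int/measurable_EFinP ? /measurable_int/measurable_EFinP].
Qed.

Lemma integrable_mul_bounded (u h : 'rV[R]_n -> R) :
  mu.-integrable setT (fun x => (u x)%:E) -> measurable_fun [set: 'rV[R]_n] h ->
  (forall x, `|h x| <= 1) -> mu.-integrable setT (fun x => (u x * h x)%:E).
Proof.
move=> iu mh h1.
have := integrableMl measurableT iu mh; apply.
exists 1; split; [exact: num_real | move=> M M1 x _].
exact: (le_trans (h1 x) (ltW M1)).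
Qed.

Lemma cintegrableM f (h : 'rV[R]_n -> R[i]) : cintegrable f ->
  cmeasurable h -> (forall x, `|complex.Re (h x)| <= 1) ->
  (forall x, `|complex.Im (h x)| <= 1) -> cintegrable (fun x => f x * h x).
Proof.
move=> [f1 f2] [h1 h2] bR bI; split.
  under eq_fun do rewrite complex_ReM EFinB.
  by apply: integrableB => //; exact: integrable_mul_bounded.
under eq_fun do rewrite complex_ImM EFinD.
by apply: integrableD => //; exact: integrable_mul_bounded.
Qed.

Lemma cintegralZ (c : R[i]) f : cintegrable f ->
  cintegral (fun x => c * f x) = c * cintegral f.
Proof.
move=> [f1 f2].
have iZ k u : mu.-integrable setT (fun x => (u x)%:E) ->
    mu.-integrable setT (fun x => (k * u x)%:E).
  by move=> iu; under eq_fun do rewrite EFinM; exact: integrableZl.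
apply: complex_eq; rewrite /cintegral /=.
  under eq_Rintegral do rewrite complex_ReM.
  rewrite RintegralB ?RintegralZl ?complex_ReM//; exact: iZ.
under eq_Rintegral do rewrite complex_ImM.
rewrite RintegralD ?RintegralZl ?complex_ImM//; exact: iZ.
Qed.

Lemma cintegralB f g : cintegrable f -> cintegrable g ->
  cintegral (fun x => f x - g x) = cintegral f - cintegral g.
Proof.
move=> [f1 f2] [g1 g2].
apply: complex_eq; rewrite /cintegral /=.
  by under eq_Rintegral do rewrite complex_ReB; rewrite RintegralB.
by under eq_Rintegral do rewrite complex_ImB; rewrite RintegralB.
Qed.

Lemma cintegrableB f g : cintegrable f -> cintegrable g ->
  cintegrable (fun x => f x - g x).
Proof.
move=> [f1 f2] [g1 g2]; split.
  by under eq_fun do rewrite complex_ReB EFinB; exact: integrableB.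
by under eq_fun do rewrite complex_ImB EFinB; exact: integrableB.
Qed.

Lemma Re_realM (k : R) (a : R[i]) : complex.Re (k%:C%C * a) = k * complex.Re a.
Proof. by rewrite complex_ReM /= mul0r subr0. Qed.

Lemma Im_realM (k : R) (a : R[i]) : complex.Im (k%:C%C * a) = k * complex.Im a.
Proof. by rewrite complex_ImM /= mul0r addr0. Qed.

Lemma cintegral_dilation (eps : R) g : 0 < eps -> cmeasurable g ->
  cintegral (dilation eps g) = cintegral g.
Proof.
move=> e0 [m1 m2]; rewrite /cintegral /dilation; congr Complex.
  under eq_Rintegral do rewrite Re_realM.
  exact: (Rintegral_dilation e0 m1).
under eq_Rintegral do rewrite Im_realM.
exact: (Rintegral_dilation e0 m2).
Qed.

Lemma cintegrable_dilation (eps : R) g : 0 < eps -> cintegrable g ->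
  cintegrable (dilation eps g).
Proof.
move=> e0 [i1 i2]; split; rewrite /dilation.
  under eq_fun do rewrite Re_realM.
  exact: (integrable_dilation e0 i1).
under eq_fun do rewrite Im_realM.
exact: (integrable_dilation e0 i2).
Qed.

Lemma dotpZl (c : R) x y : dotp (c *: x) y = c * dotp x y.
Proof. by rewrite /dotp mulr_sumr; apply: eq_bigr => i _; rewrite mxE mulrA. Qed.

Lemma dotpZr (c : R) x y : dotp x (c *: y) = c * dotp x y.
Proof. by rewrite /dotp mulr_sumr; apply: eq_bigr => i _; rewrite mxE mulrCA. Qed.

Lemma dotpBl x y xi : dotp (x - y) xi = dotp x xi - dotp y xi.
Proof. by rewrite /dotp -sumrB; apply: eq_bigr => i _; rewrite !mxE mulrBl. Qed.

Lemma measurable_dotp xi :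
  measurable_fun [set: 'rV[R]_n] (fun x : 'rV[R]_n => dotp x xi).
Proof.
rewrite /dotp; apply: measurable_sum => i.
by apply: measurable_funM => //; exact: measurable_coord.
Qed.

Lemma measurable_cos_dotp xi :
  measurable_fun [set: 'rV[R]_n] (fun x : 'rV[R]_n => cos (dotp x xi)).
Proof.
apply: (measurableT_comp _ (measurable_dotp xi)).
by apply: continuous_measurable_fun; exact: continuous_cos.
Qed.

Lemma measurable_sin_dotp xi :
  measurable_fun [set: 'rV[R]_n] (fun x : 'rV[R]_n => sin (dotp x xi)).
Proof.
apply: (measurableT_comp _ (measurable_dotp xi)).
by apply: continuous_measurable_fun; exact: continuous_sin.
Qed.

Lemma cintegrable_fourier f xi : cintegrable f -> cintegrable
  (fun x => f x * Complex (cos (dotp x xi)) (- sin (dotp x xi))).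
Proof.
move=> fi; apply: cintegrableM => //=.
- split => /=; first exact: measurable_cos_dotp.
  exact: (measurableT_comp _ (measurable_sin_dotp xi)).
- by move=> x; exact: cos_max.
- by move=> x; rewrite normrN; exact: sin_max.
Qed.

(** The pairing of [eps^-1 *: x] with [eps *: xi] is that of x with xi, so the left integrand is the
    dilation of the integrand at frequency [eps *: xi]. *)
Lemma fourier_dilation (eps : R) g xi : 0 < eps -> cintegrable g ->
  fourier (dilation eps g) xi = fourier g (eps *: xi).
Proof.
move=> e0 ig.
pose G x := g x * Complex (cos (dotp x (eps *: xi))) (- sin (dotp x (eps *: xi))).
rewrite -[RHS]/(cintegral G) -(cintegral_dilation e0); last first.
  exact/cintegrable_measurable/cintegrable_fourier.
congr cintegral; apply/funext => x; rewrite /dilation /G -!mulrA.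
have -> // : dotp (eps^-1 *: x) (eps *: xi) = dotp x xi.
by rewrite dotpZl dotpZr mulrA mulVf ?gt_eqF// mul1r.
Qed.

Lemma fourierB f g xi : cintegrable f -> cintegrable g ->
  fourier (fun x => f x - g x) xi = fourier f xi - fourier g xi.
Proof.
move=> fi gi; rewrite /fourier -cintegralB; [|exact: cintegrable_fourier..].
by congr cintegral; apply/funext => x; rewrite mulrBl.
Qed.

(** The character exp(i <x, xi>), the complex conjugate of the kernel of [fourier]. *)
Definition plane_wave xi : 'rV[R]_n -> R[i] :=
  fun x => Complex (cos (dotp x xi)) (sin (dotp x xi)).

Lemma normc_plane_wave xi x : Normc.normc (plane_wave xi x) = 1.
Proof. by rewrite /= cos2Dsin2 sqrtr1. Qed.

(** The character at x - y splits into its value at x times the Fourier kernel at y: plane waves are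
    eigenfunctions of convolution. *)
Lemma convolution_plane_wave g xi x : cintegrable g ->
  convolution (plane_wave xi) g x = plane_wave xi x * fourier g xi.
Proof.
move=> ig; rewrite /fourier -cintegralZ; last exact: cintegrable_fourier.
congr cintegral; apply/funext => y; rewrite mulrCA mulrC; congr (_ * _).
rewrite /plane_wave dotpBl cosB sinB; apply: complex_eq; rewrite /= ?mulrN ?opprK//.
by rewrite addrC.
Qed.

End complex_integral.

(** * Besov norm and approximation error of a plane wave *)

Section besov_plane_wave.
Context {R : realType} {n : nat}.
Local Notation mu := (lebesgue_rV n : {measure set 'rV[R]_n -> \bar R}).
Implicit Types (f g : 'rV[R]_n -> R[i]) (x y xi : 'rV[R]_n).

Lemma schwartz_cintegrable f : schwartz f -> cintegrable f.
Proof. by move=> [s1 s2]; split; exact: real_schwartz_integrable. Qed.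

Lemma enormZ (c : R) x : enorm (c *: x) = `|c| * enorm x.
Proof.
by rewrite /enorm dotpZl dotpZr mulrA -expr2 sqrtrM ?sqr_ge0// sqrtr_sqr.
Qed.

Lemma cutoff_fourier1 (zeta : 'rV[R]_n -> R[i]) xi :
  littlewood_paley_cutoff zeta -> enorm xi <= 1 -> fourier zeta xi = 1.
Proof. by move=> [_ _ [U [_ BU U1]]] xi1; apply/U1/BU. Qed.

Lemma lp_block_plane_wave (zeta : 'rV[R]_n -> R[i]) xi j :
  littlewood_paley_cutoff zeta -> enorm xi <= 1 ->
  lp_block zeta (plane_wave xi) j = if j == 0%N then plane_wave xi else fun=> 0.
Proof.
move=> hz xi1; have [/schwartz_cintegrable iz _ _] := hz.
rewrite /lp_block; case: ifPn => j0; apply/funext => x.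
  by rewrite convolution_plane_wave// cutoff_fourier1// mulr1.
(* For j >= 1 the frequencies 2^(1-j) xi and 2^(-j) xi lie in the unit ball, so
   the transform of lp_phi is 1 - 1 there. *)
have i2 : cintegrable (dilation 2^-1 zeta) by exact: cintegrable_dilation.
have iphi : cintegrable (lp_phi zeta) by exact: cintegrableB.
have c0 : 0 < 2 `^ (1 - j%:R) :> R by rewrite powR_gt0.
have c1 : 2 `^ (1 - j%:R) <= 1 :> R.
  rewrite -[leRHS](powRr0 2) ler_powR//; first by rewrite ler1n.
  by rewrite subr_le0 ler1n lt0n.
rewrite convolution_plane_wave; last exact: cintegrable_dilation.
have small : enorm (2 `^ (1 - j%:R) *: xi) <= 1.
  rewrite enormZ gtr0_norm//; apply: mulr_ile1 => //.
  exact: sqrtr_ge0.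
rewrite fourier_dilation// fourierB// fourier_dilation// !cutoff_fourier1//.
  by rewrite subrr mulr0.
rewrite enormZ gtr0_norm//; apply: mulr_ile1 => //; first exact: sqrtr_ge0.
by rewrite invf_le1// ler1n.
Qed.

(** [Lnorm] at exponent +oo tests whether the whole space has positive measure before taking an
    essential supremum; the first hypothesis selects that branch. *)
Lemma cLnormy_const f (c : R) : (0 < mu setT)%E ->
  (forall x, Normc.normc (f x) = c) -> cLnorm +oo%E f = c%:E.
Proof.
move=> mu0 fc; rewrite /cLnorm unlock mu0.
rewrite (_ : _ \o _ = cst c%:E); first exact: ess_sup_cst.
have c0 : 0 <= c by rewrite -(fc 0); case: (f 0) => a b; exact: sqrtr_ge0.
by apply/funext => x /=; rewrite fc ger0_norm.
Qed.

Lemma in_Lpy_plane_wave xi : (0 < mu setT)%E -> in_Lp +oo%E (plane_wave xi).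
Proof.
move=> mu0; split; last first.
  by rewrite (cLnormy_const mu0 (normc_plane_wave xi)) ltry.
by split; [exact: measurable_cos_dotp | exact: measurable_sin_dotp].
Qed.

(** The frequency lies where all blocks of index at least 1 vanish, so the series collapses to its
    term j = 0. *)
Lemma besov_norm_plane_wave_lty (zeta : 'rV[R]_n -> R[i]) (s : R) xi :
  (0 < mu setT)%E -> littlewood_paley_cutoff zeta -> enorm xi <= 1 ->
  (besov_norm_pow zeta s +oo%E 1 (plane_wave xi) < +oo)%E.
Proof.
move=> mu0 hz xi1; rewrite /besov_norm_pow /besov_seminorm_pow.
rewrite (cLnormy_const mu0 (normc_plane_wave xi)) nneseries_recl//; last first.
  by move=> k _; rewrite mule_ge0 ?lee_fin ?powR_ge0 ?poweR_ge0.
rewrite lp_block_plane_wave//= (cLnormy_const mu0 (normc_plane_wave xi)).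
rewrite eseries0 => [|i i1 _].
  by rewrite adde0 -EFinM -EFinD ltry.
rewrite lp_block_plane_wave// gtn_eqF//.
rewrite (@cLnormy_const _ 0)//; last by move=> x; rewrite /= expr0n/= addr0 sqrtr0.
by rewrite poweRe1// mule0.
Qed.

(** The error is the plane wave times the constant [1 - fourier rho (eps *: xi)], hence of constant
    modulus. *)
Lemma approximation_error_plane_wave (rho : 'rV[R]_n -> R[i]) (eps : R) xi :
  (0 < mu setT)%E -> 0 < eps -> cintegrable rho ->
  cLnorm +oo%E (fun x => plane_wave xi x -
    convolution (plane_wave xi) (dilation eps rho) x) =
  (Normc.normc (1 - fourier rho (eps *: xi)))%:E.
Proof.
move=> mu0 e0 ir; apply: cLnormy_const => // x.
rewrite convolution_plane_wave; last exact: cintegrable_dilation.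
rewrite fourier_dilation// -[X in X - _]mulr1 -mulrBr Normc.normcM.
by rewrite normc_plane_wave mul1r.
Qed.

End besov_plane_wave.

(** * The one-dimensional lower bound *)

Section moment.
Context {R : realType}.

(* Without measurability of g, unlike ge0_le_integral: the measurability of
   eps |-> |f - f * rho_eps| is then never needed. *)
Lemma ge0_le_integral_nonmeasurable d (T : measurableType d)
    (mu : {measure set T -> \bar R}) (D : set T) (f g : T -> \bar R) :
  (forall x, D x -> 0 <= f x)%E -> (forall x, D x -> f x <= g x)%E ->
  (\int[mu]_(x in D) f x <= \int[mu]_(x in D) g x)%E.
Proof.
move=> f0 fg.
rewrite !ge0_integralE//; last by move=> x Dx; exact: le_trans (f0 _ Dx) (fg _ Dx).
apply: le_ereal_sup => _ [h /= hf <-]; exists h => //= x.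
apply: le_trans (hf x) _; rewrite /patch; case: ifPn => // xD.
by apply: fg; rewrite inE in xD.
Qed.

Lemma cos_half_lt1 : cos (2^-1 : R) < 1.
Proof.
have p2 := pi_ge2 R.
have h0 : (0 : R) \in `[0, pi] by rewrite in_itv/= lexx pi_ge0.
have h1 : (2^-1 : R) \in `[0, pi] by rewrite in_itv/=; apply/andP; split; lra.
by rewrite -[ltRHS]cos0 ltr_cos// invr_gt0.
Qed.

Lemma measurable_powRN_cos (p t : R) : measurable_fun [set: R]
  (fun x => (x `^ p)^-1 * (1 - cos (x * t))).
Proof.
apply: measurable_funM.
  under eq_fun do rewrite -powRN; exact: measurable_powR.
apply: measurable_funB => //.
apply: (measurableT_comp (f := @cos R)).
  by apply: continuous_measurable_fun; exact: continuous_cos.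
exact: measurable_funM.
Qed.

(** On the interval [D] below, x|t| lies in ]1/2, 1[, so 1 - cos(xt) is at least 1 - cos(1/2) and
    the weight at least |t|^(s+1); the length 1/(2|t|) of [D] leaves |t|^s / 2. The condition on t
    puts [D] inside ]0, 1[. *)
Lemma integral_one_sub_cos_ge (s t : R) : 0 < s -> 1 <= `|t| ->
  (((1 - cos (2^-1)) / 2 * `|t| `^ s)%:E <=
   \int[@lebesgue_measure R]_(x in `]0%R, 1%R[)
     ((x `^ (s + 1))^-1 * (1 - cos (x * t)))%:E)%E.
Proof.
move=> s0 t1; set c := 1 - cos _.
have t0 : 0 < `|t| by rewrite (lt_le_trans ltr01).
have c0 : 0 <= c by rewrite subr_ge0 ltW// cos_half_lt1.
have a0 : 0 < 2^-1 * `|t|^-1 by rewrite mulr_gt0 ?invr_gt0.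
pose D := `](2^-1 * `|t|^-1), `|t|^-1[%classic : set R.
have ab : 2^-1 * `|t|^-1 < `|t|^-1.
  by rewrite gtr_pMl ?invr_gt0// invf_lt1// ltr1n.
have F0 x : 0 <= (x `^ (s + 1))^-1 * (1 - cos (x * t)).
  by rewrite mulr_ge0 ?invr_ge0 ?powR_ge0// subr_ge0 cos_le1.
have mF : measurable_fun [set: measurableTypeR R]
    (fun x : R => ((x `^ (s + 1))^-1 * (1 - cos (x * t)))%:E).
  by apply/measurable_EFinP; exact: measurable_powRN_cos.
apply: (@le_trans _ _ (\int[@lebesgue_measure R]_(x in D)
    ((x `^ (s + 1))^-1 * (1 - cos (x * t)))%:E)%E); last first.
  apply: ge0_subset_integral => //=.
  - exact: measurable_itv.
  - exact: (measurable_funTS mF).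
  - by move=> x _; rewrite lee_fin.
  - move=> x; rewrite /D/= !in_itv/= => /andP[x1 x2].
    by rewrite (lt_trans a0 x1) (lt_le_trans x2)// invf_le1.
apply: (@le_trans _ _ (\int[@lebesgue_measure R]_(x in D)
    (cst (c * `|t| `^ (s + 1))%:E x))%E).
  rewrite integral_cst/=; last exact: measurable_itv.
  rewrite /D lebesgue_measure_itv/= lte_fin ab -EFinB -EFinM lee_fin.
  rewrite powRD; last by rewrite (gt_eqF t0) implybT.
  rewrite powRr1// [leRHS](_ : _ = c / 2 * `|t| `^ s)//.
  by field; rewrite gt_eqF.
apply: ge0_le_integral_nonmeasurable => x; rewrite /D/= in_itv/= => /andP[x1 x2].
  by rewrite lee_fin mulr_ge0// powR_ge0.
have x0 : 0 < x by exact: lt_trans x1.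
have xt1 : x * `|t| < 1 by rewrite -ltr_pdivlMr// mul1r.
have xt2 : 2^-1 < x * `|t| by rewrite -ltr_pdivrMr.
rewrite lee_fin mulrC; apply: ler_pM => //.
- rewrite -[leRHS]mul1r ler_pdivlMr ?powR_gt0// mulrC -(powRM _ (ltW x0) (ltW t0)).
  apply: (@le_trans _ _ (1 `^ (s + 1))); last by rewrite powR1.
  by apply: ge0_ler_powR; rewrite ?nnegrE ?addr_ge0 ?mulr_ge0 ?ler01//; exact: ltW.
(* The cosine is even and decreases on [0, pi], which contains [1/2, 1] because pi >= 2. *)
- rewrite /c lerD2l lerN2 -(cos_norm (x * t)) normrM (gtr0_norm x0).
  have p2 := pi_ge2 R.
  have h1 : (2^-1 : R) \in `[0, pi] by rewrite in_itv/=; apply/andP; split; lra.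
  have h2 : x * `|t| \in `[0, pi] by rewrite in_itv/=; apply/andP; split; lra.
  by rewrite leNgt ltr_cos// -leNgt ltW.
Qed.

End moment.

(** * Lower bounds for a nonnegative kernel *)

Section positive_kernel.
Context {R : realType} {n : nat}.
Local Notation mu := (lebesgue_rV n : {measure set 'rV[R]_n -> \bar R}).
Implicit Types (f : 'rV[R]_n -> R[i]) (x y xi : 'rV[R]_n).

Lemma normc_sqrtE (z : R[i]) :
  Normc.normc z = Num.sqrt (complex.Re z ^+ 2 + complex.Im z ^+ 2).
Proof. by case: z. Qed.

Lemma normRe_le_normc (z : R[i]) : `|complex.Re z| <= Normc.normc z.
Proof.
by rewrite normc_sqrtE -sqrtr_sqr ler_sqrt ?lerDl ?sqr_ge0// addr_ge0 ?sqr_ge0.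
Qed.

Lemma normIm_le_normc (z : R[i]) : `|complex.Im z| <= Normc.normc z.
Proof.
by rewrite normc_sqrtE -sqrtr_sqr ler_sqrt ?lerDr ?sqr_ge0// addr_ge0 ?sqr_ge0.
Qed.

Lemma measurable_sqrt : measurable_fun [set: R] (@Num.sqrt R).
Proof. by apply: continuous_measurable_fun; exact: sqrt_continuous. Qed.

Lemma measurable_normc f : cmeasurable f ->
  measurable_fun [set: 'rV[R]_n] (fun x => Normc.normc (f x)).
Proof.
move=> [m1 m2]; under eq_fun do rewrite normc_sqrtE.
apply: (measurableT_comp measurable_sqrt).
by apply: measurable_funD; exact: measurable_funX.
Qed.

Lemma measurable_enorm : measurable_fun [set: 'rV[R]_n] (@enorm R n).
Proof.
apply: (measurableT_comp measurable_sqrt); rewrite /dotp.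
by apply: measurable_sum => i; apply: measurable_funM; exact: measurable_coord.
Qed.

Lemma in_L1_cintegrable f : in_Lp 1%E f -> cintegrable f.
Proof.
move=> [mf]; have mN := measurable_normc mf.
rewrite /cLnorm Lnorm1 => fN.
have iN : mu.-integrable setT (fun x => (Normc.normc (f x))%:E).
  by apply/integrableP; split => //; exact/measurable_EFinP.
case: mf => m1 m2.
split; apply: (le_integrable _ _ _ iN) => //.
- exact/measurable_EFinP.
- move=> x _; rewrite !abse_EFin lee_fin.
  by rewrite (le_trans (normRe_le_normc _))// ler_norm.
- exact/measurable_EFinP.
- move=> x _; rewrite !abse_EFin lee_fin.
  by rewrite (le_trans (normIm_le_normc _))// ler_norm.
Qed.

(** On a space of measure zero every integral vanishes, so an integral equal to 1 forces positive
    measure. *)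
Lemma lebesgue_rV_setT_gt0 f : cintegral f = 1 -> cmeasurable f ->
  (0 < mu setT)%E.
Proof.
move=> f1 [m1 _]; rewrite lt0e measure_ge0 andbT; apply/eqP => mu0.
have := congr1 (@complex.Re R) f1; rewrite /= /Rintegral.
rewrite null_set_integral//; last exact/measurable_EFinP.
by move/eqP; rewrite eq_sym oner_eq0.
Qed.

(** Writing 1 as the integral of rho, the real part of [1 - fourier rho xi] is the integral on the
    left, as rho is real almost everywhere. Truncating by [Num.max 0] makes the integrand
    nonnegative at every point, as Tonelli will require. *)
Lemma approximation_error_ge (rho : 'rV[R]_n -> R[i]) xi :
  cintegrable rho -> cintegral rho = 1 ->
  {ae mu, forall y, 0 <= rho y} ->
  (\int[mu]_y (Num.max 0 (complex.Re (rho y)) * (1 - cos (dotp y xi)))%:E <=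
   (Normc.normc (1 - fourier rho xi))%:E)%E.
Proof.
move=> irho rho1 rho0.
have iF := cintegrable_fourier xi irho.
have [iB _] := cintegrableB irho iF.
have [mrho _] := cintegrable_measurable irho.
apply: (@le_trans _ _ (complex.Re (1 - fourier rho xi))%:E); last first.
  by rewrite lee_fin (le_trans (ler_norm _))// normRe_le_normc.
rewrite -rho1 -cintegralB// /cintegral /= /Rintegral fineK; last first.
  exact: integrable_fin_num iB.
rewrite le_eqVlt; apply/orP; left; apply/eqP; apply: ae_eq_integral => //.
- apply/measurable_EFinP; apply: measurable_funM.
    by apply: measurable_maxr => //; exact: measurable_cst.
  by apply: measurable_funB => //; exact: measurable_cos_dotp.
- exact: measurable_int iB.
(* In [R[i]], [0 <= z] says that z is real with nonnegative real part. *)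
apply: filterS rho0 => y; rewrite lecE /= => /andP[/eqP im0 re0] _.
by rewrite complex_ReB complex_ReM /= im0 mul0r subr0 max_r// mulrBr mulr1.
Qed.

(** Tonelli reduces the claim to a bound in eps for each fixed y. The truncation max(0, |t|^s - 1)
    vanishes for |t| <= 1, where [integral_one_sub_cos_ge] says nothing, yet differs from |t|^s by
    at most 1. *)
Lemma integral_approximation_error_ge (rho : 'rV[R]_n -> R[i]) (s : R) xi :
  0 < s -> cmeasurable rho ->
  exists2 c : R, 0 < c &
  (\int[mu]_y (Num.max 0 (complex.Re (rho y)) *
     (c * Num.max 0 (`|dotp y xi| `^ s - 1)))%:E <=
   \int[@lebesgue_measure R]_(eps in `]0%R, 1%R[)
     (((eps `^ (s + 1))^-1)%:E *
      \int[mu]_y (Num.max 0 (complex.Re (rho y)) *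
                  (1 - cos (dotp y (eps *: xi))))%:E))%E.
Proof.
move=> s0 [mrho _]; set r := fun y => Num.max 0 (complex.Re (rho y)).
have r0 y : 0 <= r y by rewrite /r le_max lexx.
have mr : measurable_fun [set: 'rV[R]_n] r.
  by apply: measurable_maxr => //; exact: measurable_cst.
pose c := (1 - cos (2^-1 : R)) / 2.
have c0 : 0 < c by rewrite divr_gt0// subr_gt0 cos_half_lt1.
exists c => //.
(* The indicator of ]0, 1[ is absorbed into the weight, so that Tonelli is applied on the whole
   product space. *)
pose w (eps : R) : R := \1_(`]0%R, 1%R[%classic) eps * (eps `^ (s + 1))^-1.
have w0 eps : 0 <= w eps by rewrite mulr_ge0 ?invr_ge0 ?powR_ge0.
pose K (z : R * 'rV[R]_n) : \bar R :=
  (w z.1 * (r z.2 * (1 - cos (z.1 * dotp z.2 xi))))%:E.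
have g0 y (e : R) : 0 <= r y * (1 - cos (e * dotp y xi)).
  by rewrite mulr_ge0 ?r0// subr_ge0 cos_le1.
have K0 z : (0 <= K z)%E by rewrite lee_fin mulr_ge0.
have mw : measurable_fun [set: R] w.
  apply: measurable_funM; first exact: measurable_indic.
  by under eq_fun do rewrite -powRN; exact: measurable_powR.
have mK : measurable_fun [set: R * 'rV[R]_n] K.
  apply/measurable_EFinP; apply: measurable_funM.
    exact: (measurableT_comp mw measurable_fst).
  apply: measurable_funM; first exact: (measurableT_comp mr measurable_snd).
  apply: measurable_funB => //.
  apply: (measurableT_comp (f := @cos R)).
    by apply: continuous_measurable_fun; exact: continuous_cos.
  apply: measurable_funM; first exact: measurable_fst.
  exact: (measurableT_comp (measurable_dotp xi) measurable_snd).
have -> : (\int[@lebesgue_measure R]_(eps in `]0%R, 1%R[)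
     (((eps `^ (s + 1))^-1)%:E *
      \int[mu]_y (r y * (1 - cos (dotp y (eps *: xi))))%:E) =
   \int[@lebesgue_measure R]_eps \int[mu]_y K (eps, y))%E.
  rewrite integral_mkcond; apply: eq_integral => eps _.
  rewrite (_ : (fun y => _) = fun y => ((w eps)%:E *
      (r y * (1 - cos (eps * dotp y xi)))%:E)%E); last first.
    by apply/funext => y; rewrite -EFinM.
  rewrite ge0_integralZl//; last 3 first.
  - apply/measurable_EFinP; apply: measurable_funM => //.
    apply: measurable_funB => //.
    apply: (measurableT_comp (f := @cos R)).
      by apply: continuous_measurable_fun; exact: continuous_cos.
    by apply: measurable_funM => //; exact: measurable_dotp.
  - by move=> y _; rewrite lee_fin.
  - by rewrite lee_fin.
  rewrite /patch /w indicE; case: ifPn => _; last by rewrite mul0r mul0e.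
  rewrite mul1r; congr (_ * _)%E; apply: eq_integral => y _.
  by rewrite dotpZr.
(* After the exchange the inner integral runs over eps, and the integrands are compared for each
   y. *)
rewrite (fubini_tonelli (m1 := @lebesgue_measure R) (m2 := lebesgue_rV n) K)//.
apply: ge0_le_integral_nonmeasurable => y _.
  rewrite lee_fin; apply: mulr_ge0; first exact: r0.
  by rewrite mulr_ge0 ?le_max ?lexx// ltW.
have [t1|/ltW t1] := leP 1 `|dotp y xi|; last first.
  have -> : Num.max 0 (`|dotp y xi| `^ s - 1) = 0; last first.
    by rewrite !mulr0; apply: integral_ge0.
  apply: max_l.
  rewrite subr_le0 (@le_trans _ _ (1 `^ s))//; last by rewrite powR1.
  by apply: ge0_ler_powR; rewrite ?nnegrE// ltW.
apply: (@le_trans _ _ ((r y)%:E * \int[@lebesgue_measure R]_(x in `]0%R, 1%R[)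
     ((x `^ (s + 1))^-1 * (1 - cos (x * dotp y xi)))%:E)%E).
  rewrite EFinM; apply: lee_wpmul2l; first exact: r0.
  apply: le_trans (integral_one_sub_cos_ge s0 t1).
  rewrite lee_fin ler_wpM2l ?(ltW c0)// ge_max powR_ge0/=.
  by rewrite lerBlDr lerDl.
have mF : measurable_fun [set: measurableTypeR R]
    (fun x : R => ((x `^ (s + 1))^-1 * (1 - cos (x * dotp y xi)))%:E).
  by apply/measurable_EFinP; exact: measurable_powRN_cos.
rewrite -ge0_integralZl//; last 3 first.
- exact: (measurable_funTS mF).
- by move=> x _; rewrite lee_fin mulr_ge0 ?invr_ge0 ?powR_ge0// subr_ge0 cos_le1.
- exact: r0.
rewrite integral_mkcond; apply: ge0_le_integral_nonmeasurable => e _.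
  rewrite /patch; case: ifP => // _; rewrite -EFinM lee_fin.
  by rewrite mulr_ge0// mulr_ge0 ?invr_ge0 ?powR_ge0// subr_ge0 cos_le1.
rewrite /patch /K /w indicE /=; case: ifPn => _; last by rewrite !mul0r.
by rewrite -EFinM lee_fin mul1r mulrCA.
Qed.

End positive_kernel.

(** * Finite moments in a fixed direction *)

Section directional_moment.
Context {R : realType} {n : nat}.
Local Notation mu := (lebesgue_rV n : {measure set 'rV[R]_n -> \bar R}).

Lemma directional_moment (zeta rho : 'rV[R]_n -> R[i]) (s : R) xi :
  littlewood_paley_cutoff zeta -> 0 < s -> in_Lp 1%E rho ->
  cintegral rho = 1 -> {ae mu, forall y, 0 <= rho y} ->
  characterizes_besov zeta rho s -> enorm xi <= 1 ->
  (\int[mu]_y (Num.max 0 (complex.Re (rho y)) * `|dotp y xi| `^ s)%:E < +oo)%E.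
Proof.
move=> hzeta s0 hrho rho1 rho0 hchar xi1.
have irho := in_L1_cintegrable hrho.
have mrho := cintegrable_measurable irho.
have mu0 := lebesgue_rV_setT_gt0 rho1 mrho.
(* Exponents p = +oo and q = 1: the finite Besov norm of the plane wave bounds its approximation
   integral. *)
have [C [C1 hC]] := hchar +oo%E 1 (leey _) (lexx _).
have [_ happ] := hC _ (in_Lpy_plane_wave xi mu0).
have {happ} app_lty : (approximation_pow rho s +oo%E 1 (plane_wave xi) < +oo)%E.
  apply: le_lt_trans happ _; apply: lte_mul_pinfty => //.
    by rewrite lee_fin (le_trans ler01).
  exact: besov_norm_plane_wave_lty.
have [c c0 hc] := integral_approximation_error_ge xi s0 mrho.
set r := fun y => Num.max 0 (complex.Re (rho y)) in hc *.
have r0 y : 0 <= r y by rewrite /r le_max lexx.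
have mr : measurable_fun [set: 'rV[R]_n] r.
  by apply: measurable_maxr; [exact: measurable_cst | exact: mrho.1].
have mt : measurable_fun [set: 'rV[R]_n] (fun y : 'rV[R]_n => `|dotp y xi| `^ s).
  apply: (measurableT_comp (measurable_powR s)).
  exact: (measurableT_comp _ (measurable_dotp xi)).
pose h y := r y * (c * Num.max 0 (`|dotp y xi| `^ s - 1)).
have h0 y : 0 <= h y by rewrite mulr_ge0 ?r0// mulr_ge0 ?(ltW c0)// le_max lexx.
have mh : measurable_fun [set: 'rV[R]_n] h.
  apply: measurable_funM => //; apply: measurable_funM => //.
  apply: measurable_maxr => //.
  by apply: measurable_funB.
(* With q = 1 the weights match those of the lower bound; the norm term is discarded as
   nonnegative. *)
have h_lty : (\int[mu]_y (h y)%:E < +oo)%E.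
  apply: le_lt_trans hc _; apply: le_lt_trans app_lty.
  rewrite /approximation_pow mulr1 -[leLHS]add0e; apply: leeD.
    exact: poweR_ge0.
  apply: ge0_le_integral_nonmeasurable => eps /=; rewrite in_itv/= => /andP[e0 _].
    rewrite mule_ge0 ?lee_fin ?invr_ge0 ?powR_ge0// integral_ge0// => y _.
    by rewrite lee_fin mulr_ge0 ?r0// subr_ge0 cos_le1.
  apply: lee_wpmul2l; first by rewrite lee_fin invr_ge0 powR_ge0.
  rewrite approximation_error_plane_wave// poweRe1; last first.
    by rewrite lee_fin (le_trans _ (normRe_le_normc _)).
  exact: approximation_error_ge.
(* Integrability of rho pays for the 1 subtracted in the truncation. *)
have r_lty : (\int[mu]_y (r y)%:E < +oo)%E.
  have /integrableP[_ ] := irho.1; apply: le_lt_trans.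
  apply: ge0_le_integral_nonmeasurable => y _; first by rewrite lee_fin r0.
  by rewrite abse_EFin lee_fin ge_max normr_ge0 ler_norm.
(* From |t|^s <= 1 + max(0, |t|^s - 1), multiplied by [r y]; the factor [c^-1] undoes the constant
   in [h]. *)
apply: (@le_lt_trans _ _ (\int[mu]_y ((r y)%:E + c^-1%:E * (h y)%:E))%E).
  apply: ge0_le_integral_nonmeasurable => y _.
    by rewrite lee_fin mulr_ge0 ?r0 ?powR_ge0.
  rewrite -EFinM -EFinD lee_fin /h mulrCA mulKf ?gt_eqF//.
  rewrite -[X in X + _]mulr1 -mulrDr ler_wpM2l ?r0//.
  by rewrite -lerBlDl le_max lexx orbT.
have mrE : measurable_fun [set: 'rV[R]_n] (EFin \o r) by exact/measurable_EFinP.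
have mhE : measurable_fun [set: 'rV[R]_n] (EFin \o h) by exact/measurable_EFinP.
have ic0 : (0 <= c^-1%:E)%E by rewrite lee_fin invr_ge0 ltW.
rewrite ge0_integralD//; last 3 first.
- by move=> y _; rewrite lee_fin r0.
- by move=> y _; rewrite mule_ge0// lee_fin.
- exact: measurable_funeM.
rewrite ge0_integralZl//; last by move=> y _; rewrite lee_fin.
by rewrite lte_add_pinfty// lte_mul_pinfty.
Qed.

End directional_moment.

(** * From coordinate directions to the full moment *)

Lemma enorm_delta (R : realType) n (k : 'I_n) :
  enorm (delta_mx ord0 k : 'rV[R]_n) = 1.
Proof.
rewrite /enorm /dotp (bigD1 k)//= big1 => [|j jk].
  by rewrite mxE !eqxx mulr1 addr0 sqrtr1.
by rewrite mxE (negbTE jk) andbF mulr0.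
Qed.

Lemma dotp_delta (R : realType) n (y : 'rV[R]_n) (k : 'I_n) :
  dotp y (delta_mx ord0 k) = y ord0 k.
Proof.
rewrite /dotp (bigD1 k)//= big1 => [|j jk].
  by rewrite mxE !eqxx mulr1 addr0.
by rewrite mxE (negbTE jk) andbF mulr0.
Qed.

(** The Euclidean norm is at most n times the largest coordinate, whose power is one term of the
    sum; n > 0 provides such a coordinate. *)
Lemma enorm_powR_le (R : realType) n (y : 'rV[R]_n) (s : R) :
  (0 < n)%N -> 0 < s ->
  enorm y `^ s <= n%:R `^ s * \sum_(k < n) `|y ord0 k| `^ s.
Proof.
case: n y => // n y _ s0.
have [k _ hk] := arg_maxP (fun k => `|y ord0 k|) (erefl : xpredT (ord0 : 'I_n.+1)).
have le1 : enorm y <= n.+1%:R * `|y ord0 k|.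
  rewrite -(@ler_pXn2r _ 2)// ?nnegrE ?mulr_ge0 ?sqrtr_ge0// sqr_enorm.
  apply: (@le_trans _ _ (n.+1%:R * `|y ord0 k| ^+ 2)).
    have -> : n.+1%:R * `|y ord0 k| ^+ 2 = \sum_(j < n.+1) `|y ord0 k| ^+ 2.
      by rewrite sumr_const card_ord mulr_natl.
    apply: ler_sum => j _; rewrite -expr2 -(real_normK (num_real (y ord0 j))).
    by rewrite lerXn2r ?nnegrE//; exact: hk.
  (* The crude bound n <= n^2 avoids a square root in the constant. *)
  rewrite exprMn ler_wpM2r ?exprn_ge0// expr2 ler_peMr// ler1n.
  by [].
apply: (@le_trans _ _ ((n.+1%:R * `|y ord0 k|) `^ s)).
  by apply: ge0_ler_powR; rewrite ?nnegrE ?mulr_ge0 ?sqrtr_ge0 ?(ltW s0).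
rewrite powRM// ler_wpM2l ?powR_ge0// (bigD1 k)//= lerDl.
by apply: sumr_ge0 => j _; exact: powR_ge0.
Qed.

Theorem proposition1p6 (R : realType) (n : nat) (hn : (0 < n)%N)
    (zeta : 'rV[R]_n -> R[i]) (hzeta : littlewood_paley_cutoff zeta)
    (s : R) (hs : 0 < s)
    (rho : 'rV[R]_n -> R[i]) (hrho : in_Lp 1%E rho)
    (hint : cintegral rho = 1)
    (hpos : {ae lebesgue_rV n, forall y, 0 <= rho y})
    (hchar : characterizes_besov zeta rho s) :
  (\int[lebesgue_rV n]_y (enorm y `^ s * Normc.normc (rho y))%:E < +oo)%E.
Proof.
have [mrho _] := hrho.
pose r y := Num.max 0 (complex.Re (rho y)).
have r0 y : 0 <= r y by rewrite /r le_max lexx.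
have mr : measurable_fun [set: 'rV[R]_n] r.
  by apply: measurable_maxr; [exact: measurable_cst | exact: mrho.1].
have me : measurable_fun [set: 'rV[R]_n] (fun y => enorm y `^ s).
  exact: (measurableT_comp (measurable_powR s) measurable_enorm).
(* Almost everywhere rho is real and nonnegative, so its modulus is its truncated real part [r]. *)
have -> : (\int[lebesgue_rV n]_y (enorm y `^ s * Normc.normc (rho y))%:E =
    \int[lebesgue_rV n]_y (enorm y `^ s * r y)%:E)%E.
  apply: ge0_ae_eq_integral => //.
  - apply/measurable_EFinP; apply: measurable_funM => //.
    exact: measurable_normc.
  - by apply/measurable_EFinP; exact: measurable_funM.
  - move=> y _; rewrite lee_fin mulr_ge0 ?powR_ge0//.
    by rewrite (le_trans _ (normRe_le_normc _)).
  - by move=> y _; rewrite lee_fin mulr_ge0 ?powR_ge0.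
  apply: filterS hpos => y; rewrite lecE /= => /andP[/eqP im0 re0] _.
  by rewrite /r max_r// normc_sqrtE im0 expr0n/= addr0 sqrtr_sqr ger0_norm.
pose m k y : \bar R := (r y * `|y ord0 k| `^ s)%:E.
have m0 k y : (0 <= m k y)%E by rewrite lee_fin mulr_ge0 ?powR_ge0.
have mm k : measurable_fun [set: 'rV[R]_n] (m k).
  apply/measurable_EFinP; apply: measurable_funM => //.
  apply: (measurableT_comp (measurable_powR s)).
  exact: (measurableT_comp _ (measurable_coord (T2 := R) k)).
apply: (@le_lt_trans _ _
  (\int[lebesgue_rV n]_y ((n%:R `^ s)%:E * \sum_(k < n) m k y))%E).
  apply: ge0_le_integral_nonmeasurable => y _.
    by rewrite lee_fin mulr_ge0 ?powR_ge0.
  rewrite sumEFin -EFinM lee_fin -mulr_sumr mulrCA mulrC ler_wpM2l//.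
  exact: enorm_powR_le.
rewrite ge0_integralZl//; last 2 first.
- exact: emeasurable_sum.
- by move=> y _; exact: sume_ge0.
rewrite ge0_integral_sum//; apply: lte_mul_pinfty => //.
apply: lte_sum_pinfty => k _.
(* Unit coordinate vectors are admissible frequencies, and pairing with the k-th one returns the
   k-th coordinate. *)
have xi1 : enorm (delta_mx ord0 k : 'rV[R]_n) <= 1 by rewrite enorm_delta.
have := directional_moment hzeta hs hrho hint hpos hchar xi1.
by rewrite (eq_integral (m k))// => y _; rewrite /m /r dotp_delta.
Qed.
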